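(* Let $i\in\{1,2,3\}$. If $\mathbf U,\tilde{\mathbf U}\in\mathcal G$, then the inequality $$\Big(\mathbf U-\frac{\mathbf F_i(\mathbf U)}{\alpha}+\tilde{\mathbf U}+\frac{\mathbf F_i(\tilde{\mathbf U})}{\alpha}\Big)\cdot\mathbf n^*+|\mathbf B^*|^2+\frac{B_i-\tilde B_i}{\alpha}(\mathbf v^*\cdot\mathbf B^* )>0$$ holds for any $\mathbf v^*,\mathbf B^*\in\mathbb R^3$ and any real $\alpha$ with $|\alpha|>\alpha_i(\mathbf U,\tilde{\mathbf U})$, where $\mathbf n^*=\big(\frac{|\mathbf v^*|^2}{2},-\mathbf v^*,-\mathbf B^*,1\big)^\top$ and $$\alpha_i(\mathbf U,\tilde{\mathbf U})=\min_{\sigma\in\mathbb R}\alpha_i(\mathbf U,\tilde{\mathbf U};\sigma),$$ $$\alpha_i(\mathbf U,\tilde{\mathbf U};\sigma)=\max\big\{|v_i|+\mathscr C_i,\ |\tilde v_i|+\tilde{\mathscr C}_i,\ |\sigma v_i+(1-\sigma)\tilde v_i|+\max\{\mathscr C_i,\tilde{\mathscr C}_i\}\big\}+\frac{|\tilde{\mathbf B}-\mathbf B|}{\sqrt2}\sqrt{\frac{\sigma^2}{\rho}+\frac{(1-\sigma)^2}{\tilde\rho}}.$$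
   Context: A state is $\mathbf U=(\rho,\mathbf m,\mathbf B,E)^\top\in\mathbb R^8$ with $\rho,E\in\mathbb R$, $\mathbf m,\mathbf B\in\mathbb R^3$. For $\rho>0$ put $\mathbf v=\mathbf m/\rho$, $\mathcal E(\mathbf U)=E-\frac12\big(\frac{|\mathbf m|^2}{\rho}+|\mathbf B|^2\big)$, $e=\mathcal E(\mathbf U)/\rho$, $p=p(\rho,e)$, $p_{tot}=p+\frac{|\mathbf B|^2}{2}$. The equation of state $p(\rho,e)$ is any function such that, whenever $\rho>0$, one has $e>0\Leftrightarrow p(\rho,e)>0$. Admissible states: $\mathcal G=\{\mathbf U:\rho>0,\ \mathcal E(\mathbf U)>0\}$. Flux: $$\mathbf F_i(\mathbf U)=\big(\rho v_i,\ \rho v_i\mathbf v-B_i\mathbf B+p_{tot}\mathbf e_i,\ v_i\mathbf B-B_i\mathbf v,\ v_i(E+p_{tot})-B_i(\mathbf v\cdot\mathbf B)\big)^\top,$$ with $\mathbf e_i$ the $i$-th standard unit vector of $\mathbb R^3$. For $\mathbf U\in\mathcal G$, $$\mathscr C_i=\frac1{\sqrt2}\Big[\mathscr C_s^2+\frac{|\mathbf B|^2}{\rho}+\sqrt{\Big(\mathscr C_s^2+\frac{|\mathbf B|^2}{\rho}\Big)^2-4\frac{\mathscr C_s^2B_i^2}{\rho}}\Big]^{1/2},\qquad \mathscr C_s=\frac{p}{\rho\sqrt{2e}}.$$ Quantities with a tilde are the corresponding quantities for $\tilde{\mathbf U}$. *)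

(* Defs.v *)
From HB Require Import structures.
From mathcomp Require Import all_boot all_order all_algebra.
From mathcomp Require Import all_classical all_reals.

Set Implicit Arguments.
Unset Strict Implicit.
Unset Printing Implicit Defensive.

Import Order.TTheory GRing.Theory Num.Theory.

Local Open Scope classical_set_scope.
Local Open Scope ring_scope.

(* (rho, m, B, E) as a vector of R^8, in block form *)
Notation state R := 'rV[R]_(1 + (3 + (3 + 1))).

(* The norm `|u| of a row vector in the library is the sup norm, so the
   Euclidean product and norm are introduced here. *)
Definition dot (R : realType) (n : nat) (u v : 'rV[R]_n) : R :=
  \sum_(j < n) u 0 j * v 0 j.

Definition enorm (R : realType) (n : nat) (u : 'rV[R]_n) : R :=
  Num.sqrt (dot u u).

Definition is_min (R : realType) (A : set R) (a : R) : Prop :=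
  A a /\ lbound A a.

(* The value 0 is used only for sets that have no minimum. *)
Definition minimum (R : realType) (A : set R) : R :=
  xget 0 [set a | is_min A a].

Section State.
Variable R : realType.

Definition mk_state (r : R) (m B : 'rV[R]_3) (E : R) : state R :=
  row_mx r%:M (row_mx m (row_mx B E%:M)).

Definition density (U : state R) : R := lsubmx U 0 0.
Definition momentum (U : state R) : 'rV[R]_3 := lsubmx (rsubmx U).
Definition magnetic (U : state R) : 'rV[R]_3 := lsubmx (rsubmx (rsubmx U)).
Definition energy (U : state R) : R := rsubmx (rsubmx (rsubmx U)) 0 0.

Definition velocity (U : state R) : 'rV[R]_3 :=
  (density U)^-1 *: momentum U.

Definition internal_energy (U : state R) : R :=
  energy U - 2^-1 * (enorm (momentum U) ^+ 2 / density U
                     + enorm (magnetic U) ^+ 2).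

Definition specific_energy (U : state R) : R :=
  internal_energy U / density U.

Definition admissible (U : state R) : Prop :=
  0 < density U /\ 0 < internal_energy U.

Definition equation_of_state (p : R -> R -> R) : Prop :=
  forall r e : R, 0 < r -> (0 < e <-> 0 < p r e).

Definition nstar (vs Bs : 'rV[R]_3) : state R :=
  mk_state (enorm vs ^+ 2 / 2) (- vs) (- Bs) 1.

Section EquationOfState.
Variable p : R -> R -> R.

Definition pressure (U : state R) : R := p (density U) (specific_energy U).

Definition total_pressure (U : state R) : R :=
  pressure U + enorm (magnetic U) ^+ 2 / 2.

Definition flux (i : 'I_3) (U : state R) : state R :=
  let rho := density U in let v := velocity U in
  let B := magnetic U in let E := energy U in
  let ptot := total_pressure U in
  mk_state (rho * v 0 i)
           ((rho * v 0 i) *: v - B 0 i *: B + ptot *: delta_mx 0 i)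
           (v 0 i *: B - B 0 i *: v)
           (v 0 i * (E + ptot) - B 0 i * dot v B).

Definition Cs (U : state R) : R :=
  pressure U / (density U * Num.sqrt (2 * specific_energy U)).

Definition Ci (i : 'I_3) (U : state R) : R :=
  let a := Cs U ^+ 2 + enorm (magnetic U) ^+ 2 / density U in
  (Num.sqrt 2)^-1 *
  Num.sqrt (a + Num.sqrt (a ^+ 2
    - 4 * (Cs U ^+ 2 * magnetic U 0 i ^+ 2 / density U))).

Definition alpha_sigma (i : 'I_3) (U Ut : state R) (sigma : R) : R :=
  let v := velocity U 0 i in let vt := velocity Ut 0 i in
  Num.max (`|v| + Ci i U)
    (Num.max (`|vt| + Ci i Ut)
       (`|sigma * v + (1 - sigma) * vt| + Num.max (Ci i U) (Ci i Ut)))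
  + enorm (magnetic Ut - magnetic U) / Num.sqrt 2
    * Num.sqrt (sigma ^+ 2 / density U + (1 - sigma) ^+ 2 / density Ut).

Definition alpha_min (i : 'I_3) (U Ut : state R) : R :=
  minimum (range (alpha_sigma i U Ut)).

End EquationOfState.
End State.

(* Main.v *)
Require Import Defs.
From HB Require Import structures.
From mathcomp Require Import all_boot all_order all_algebra.
From mathcomp Require Import all_classical all_reals.
From mathcomp Require Import ring lra.
From mathcomp Require Import topology normedtype derive realfun.

Set Implicit Arguments.
Unset Strict Implicit.
Unset Printing Implicit Defensive.

Import Order.TTheory GRing.Theory Num.Theory.
Import numFieldNormedType.Exports.

(** Write [w = v - vs], [b = B - Bs] for the velocity and the magnetic field
    relative to the free parameters, and
    [W = density * |w|^2 / 2 + internal_energy + |b|^2 / 2].  The vector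
    [nstar vs Bs] is chosen so that [dot U nstar + |Bs|^2 / 2 = W], hence the
    part of the claim without fluxes is the sum [W + Wt > 0] of the two
    relative energies.  It remains to see that the flux terms, before division
    by [alpha], are at most [alpha_sigma * (W + Wt)] for every [sigma].

    Contracting the flux with [nstar] and removing [B_i (vs . Bs)] (this is the
    role of the last term of the claim) leaves, up to a term depending on
    [vs] and [Bs] only, which cancels between the two states,
    [v_i * (density * |w|^2 / 2 + internal_energy) + vs_i * |b|^2 / 2 + Q]
    (lemma [dot_flux_nstar]).  There are three contributions.

    The remainder [Q] is a quadratic form in [(w, b, sqrt internal_energy)].
    Its matrix is the symmetrised one of the magnetosonic waves, with [Cs] in
    the place of the sound speed; its spectral radius is the fast speed [Ci], so
    [|Q| <= Ci * W] (lemmas [fast_speed_form_bound] and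
    [fluctuation_flux_bound]).

    The term in [v_i] is convected with the speed of its own state.

    The term in [vs_i] is convected with an arbitrary speed, and would be out
    of control if the two states did not compensate each other.  Substituting
    [vs = (sigma v + (1 - sigma) vt) - (sigma w + (1 - sigma) wt)] replaces
    [vs_i] by the averaged velocity, up to an error proportional to
    [|b|^2 - |bt|^2], where [bt] is relative to the other state.  As
    [b - bt = B - Bt], this error is a product of [w], of the jump of [B] and
    of [b + bt], which Cauchy-Schwarz bounds by the last term of
    [alpha_sigma] times [W + Wt] (lemma [magnetic_jump_bound]).

    The minimum over [sigma] is attained because [alpha_sigma] is continuous
    and grows linearly at infinity, unless the growth rate vanishes, in which
    case it is constant. *)

Local Open Scope classical_set_scope.
Local Open Scope ring_scope.

(** * The Euclidean product *)

Section EuclideanProduct.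
Context {R : realType} {n : nat}.
Implicit Types (u v w : 'rV[R]_n) (a : R).

Lemma dotC u v : dot u v = dot v u.
Proof. by apply: eq_bigr => j _; rewrite mulrC. Qed.

Lemma dotDl u v w : dot (u + v) w = dot u w + dot v w.
Proof. by rewrite -big_split; apply: eq_bigr => j _; rewrite mxE mulrDl. Qed.

Lemma dotZl a u v : dot (a *: u) v = a * dot u v.
Proof. by rewrite mulr_sumr; apply: eq_bigr => j _; rewrite mxE mulrA. Qed.

Lemma dotNl u v : dot (- u) v = - dot u v.
Proof. by rewrite -scaleN1r dotZl mulN1r. Qed.

Lemma dotDr u v w : dot w (u + v) = dot w u + dot w v.
Proof. by rewrite dotC dotDl !(dotC _ w). Qed.

Lemma dotZr a u v : dot v (a *: u) = a * dot v u.
Proof. by rewrite dotC dotZl dotC. Qed.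

Lemma dotNr u v : dot v (- u) = - dot v u.
Proof. by rewrite dotC dotNl dotC. Qed.

Definition dotE := (dotDl, dotDr, dotNl, dotNr, dotZl, dotZr).

Lemma dot_deltal i u : dot (delta_mx 0 i) u = u 0 i.
Proof.
rewrite /dot (bigD1 i) //= big1 => [|j /negPf ji]; rewrite !mxE !eqxx.
  by rewrite mul1r addr0.
by rewrite ji mul0r.
Qed.

Lemma dotvv_ge0 u : 0 <= dot u u.
Proof. by apply: sumr_ge0 => j _; rewrite -expr2 sqr_ge0. Qed.

Lemma enorm_sqr u : enorm u ^+ 2 = dot u u.
Proof. by rewrite sqr_sqrtr ?dotvv_ge0. Qed.

Lemma sqr_coord_le_dotvv i u : u 0 i ^+ 2 <= dot u u.
Proof.
rewrite /dot (bigD1 i) //= expr2 lerDl.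
by apply: sumr_ge0 => j _; rewrite -expr2 sqr_ge0.
Qed.

End EuclideanProduct.

Lemma ler_norm_sqr (R : realType) (a b : R) :
  0 <= b -> a ^+ 2 <= b ^+ 2 -> `|a| <= b.
Proof. by move=> b0 /ler_wsqrtr; rewrite !sqrtr_sqr (ger0_norm b0). Qed.

(** Common source of the two Cauchy-Schwarz inequalities below; letting [c]
    vanish spares them the case of a null vector. *)
Lemma discriminant_le0 (R : realType) (a b c : R) :
  (forall s, 0 <= a - 2 * s * b + s ^+ 2 * c) -> b ^+ 2 <= a * c.
Proof.
move=> h.
pose q : {poly R} := Poly [:: a; - 2 * b; c].
have q0 x : 0 <= q.[x].
  by move: (h x); rewrite horner_Poly /= mul0r add0r; lra.
have size_q : (size q <= 3)%N := size_Poly _.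
by have := deg_le2_poly_ge0 size_q q0; rewrite !coef_Poly /=; lra.
Qed.

Lemma dot_sqr_le (R : realType) (n : nat) (u v : 'rV[R]_n) :
  dot u v ^+ 2 <= dot u u * dot v v.
Proof.
apply: discriminant_le0 => s.
have := dotvv_ge0 (u - s *: v); rewrite !dotE (dotC v u); lra.
Qed.

(** Cauchy-Schwarz for the components orthogonal to the [i]-th axis.  Stating
    it with the [i]-th terms subtracted avoids projecting the vectors. *)
Lemma dot_sqr_le_offcoord (R : realType) (n : nat) (i : 'I_n) (u v : 'rV[R]_n) :
  (dot u v - u 0 i * v 0 i) ^+ 2
    <= (dot u u - u 0 i ^+ 2) * (dot v v - v 0 i ^+ 2).
Proof.
apply: discriminant_le0 => s.
have := sqr_coord_le_dotvv i (u - s *: v).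
rewrite !dotE (dotC v u) !mxE; lra.
Qed.

(** * The fast magnetosonic speed as a spectral radius *)

(** With [|t| <= sqrt (A X)], this is bounded below by a quadratic form in
    [(x, sqrt X)] whose discriminant vanishes, since [P S = r^2 A].  The
    degenerate case [S = 0], in which one cannot complete the square, is
    covered too. *)
Lemma psd_form_ge0 (R : realType) (P S A X r t x : R) :
  0 <= P -> 0 <= S -> 0 <= X -> P * S = r ^+ 2 * A ->
  t ^+ 2 <= A * X -> 0 <= P * x ^+ 2 + 2 * (x * r * t) + S * X.
Proof.
move=> P0 S0 X0 PS tAX.
have b0 : 0 <= (P * x ^+ 2 + S * X) / 2.
  by rewrite divr_ge0 // addr_ge0 // mulr_ge0 // sqr_ge0.
suff : `|x * r * t| <= (P * x ^+ 2 + S * X) / 2.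
  by rewrite ler_norml => /andP[]; lra.
apply: ler_norm_sqr => //.
have : (x * r) ^+ 2 * t ^+ 2 <= x ^+ 2 * (P * S) * X.
  have -> : x ^+ 2 * (P * S) * X = (x * r) ^+ 2 * (A * X) by rewrite PS; ring.
  by rewrite ler_wpM2l ?sqr_ge0.
by have := sqr_ge0 (P * x ^+ 2 - S * X); lra.
Qed.

(** The left-hand side is [c z x_i + b . u] with
    [u = x_i beta - beta_i x], so by Cauchy-Schwarz it is enough that
    [c^2 x_i^2 + |u|^2 <= C^2 |x|^2].  In terms of [x_i] and of the part of
    [x] orthogonal to the [i]-th axis, this is a quadratic form whose
    discriminant is the biquadratic polynomial in [C] assumed to vanish; the
    last hypothesis says that [C^2] is its larger root, which gives the right
    signs to the diagonal coefficients. *)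
Lemma fast_speed_form_bound (R : realType) (n : nat) (i : 'I_n)
    (x b beta : 'rV[R]_n) (c z C : R) :
  0 <= C ->
  C ^+ 4 - (c ^+ 2 + dot beta beta) * C ^+ 2 + c ^+ 2 * beta 0 i ^+ 2 = 0 ->
  c ^+ 2 + dot beta beta <= 2 * C ^+ 2 ->
  `|c * z * x 0 i + x 0 i * dot b beta - beta 0 i * dot x b|
    <= C * ((dot x x + dot b b + z ^+ 2) / 2).
Proof.
move=> C0 eqC leC.
set u := x 0 i *: beta - beta 0 i *: x.
have offbeta := sqr_coord_le_dotvv i beta.
have offx := sqr_coord_le_dotvv i x.
have u_le : c ^+ 2 * x 0 i ^+ 2 + dot u u <= C ^+ 2 * dot x x.
  pose P := C ^+ 2 - c ^+ 2 - dot beta beta + beta 0 i ^+ 2.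
  pose S := C ^+ 2 - beta 0 i ^+ 2.
  have PS : P * S = beta 0 i ^+ 2 * (dot beta beta - beta 0 i ^+ 2).
    by apply/eqP; rewrite -subr_eq0 -eqC; apply/eqP; rewrite /P /S; ring.
  have PS0 : 0 <= P * S by rewrite PS mulr_ge0 ?sqr_ge0 ?subr_ge0.
  have PDS0 : 0 <= P + S by rewrite /P /S; lra.
  have P0 : 0 <= P by rewrite leNgt; apply/negP => P0; nra.
  have S0 : 0 <= S by rewrite leNgt; apply/negP => S0; nra.
  have X0 : 0 <= dot x x - x 0 i ^+ 2 by rewrite subr_ge0.
  have := psd_form_ge0 (x 0 i) P0 S0 X0 PS (dot_sqr_le_offcoord i beta x).
  by rewrite /P /S /u !dotE (dotC x beta); lra.
have -> : c * z * x 0 i + x 0 i * dot b beta - beta 0 i * dot x b =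
    c * x 0 i * z + dot b u by rewrite /u !dotE (dotC x b); ring.
apply: ler_norm_sqr.
  by rewrite mulr_ge0 // divr_ge0 // !addr_ge0 ?dotvv_ge0 ?sqr_ge0.
clearbody u.
have u0 := dotvv_ge0 u; have b0 := dotvv_ge0 b; have x0 := dotvv_ge0 x.
have cs : (c * x 0 i * z + dot b u) ^+ 2
    <= (z ^+ 2 + dot b b) * (c ^+ 2 * x 0 i ^+ 2 + dot u u).
  have := dot_sqr_le b u.
  have := dotvv_ge0 ((c * x 0 i) *: b - z *: u).
  by rewrite !dotE (dotC u b); lra.
apply: (le_trans cs).
apply: (@le_trans _ _ ((z ^+ 2 + dot b b) * (C ^+ 2 * dot x x))).
  by rewrite ler_wpM2l // addr_ge0 ?sqr_ge0.
have := mulr_ge0 (sqr_ge0 C) (sqr_ge0 (z ^+ 2 + dot b b - dot x x)); lra.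
Qed.

(** * Existence of minima *)

Lemma coercive_has_min (R : realType) (f : R -> R) (k l : R) :
  continuous f -> 0 < k -> (forall s, k * `|s| - l <= f s) ->
  exists s0, forall s, f s0 <= f s.
Proof.
move=> cf k0 lbf.
set r := (f 0 + l) / k.
have r0 : 0 <= r.
  by rewrite divr_ge0 ?(ltW k0) //; move: (lbf 0); rewrite normr0; lra.
have [||c _ cmin] := @EVT_min R f (- r) r; first by lra.
  by apply: continuous_subspaceT => x; exact: cf.
exists c => s; have [sr|sr] := leP `|s| r.
  by apply: cmin; rewrite in_itv /= -ler_norml.
apply: (@le_trans _ _ (f 0)).
  by apply: cmin; rewrite in_itv /= -ler_norml normr0.
apply: le_trans (lbf s).
by move: sr; rewrite ltr_pdivrMr //; lra.
Qed.

(** * States and their relative energies *)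

Section MHD.
Context {R : realType}.
Implicit Types (U : state R) (v B : 'rV[R]_3).

Lemma dot_mk_state U (r E : R) v B :
  dot U (mk_state r v B E)
  = density U * r + dot (momentum U) v + dot (magnetic U) B + energy U * E.
Proof.
rewrite /dot /mk_state !big_split_ord /= !big_ord1 -!addrA.
congr (_ + (_ + (_ + _))).
- by rewrite row_mxEl !mxE mulr1n /density mxE.
- by apply: eq_bigr => j _; rewrite row_mxEr row_mxEl !mxE.
- by apply: eq_bigr => j _; rewrite !row_mxEr row_mxEl !mxE.
- by rewrite !row_mxEr !mxE mulr1n /energy !mxE.
Qed.

Lemma density_mk (r E : R) v B : density (mk_state r v B E) = r.
Proof. by rewrite /density row_mxKl mxE mulr1n. Qed.

Lemma momentum_mk (r E : R) v B : momentum (mk_state r v B E) = v.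
Proof. by rewrite /momentum row_mxKr row_mxKl. Qed.

Lemma magnetic_mk (r E : R) v B : magnetic (mk_state r v B E) = B.
Proof. by rewrite /magnetic !row_mxKr row_mxKl. Qed.

Lemma energy_mk (r E : R) v B : energy (mk_state r v B E) = E.
Proof. by rewrite /energy !row_mxKr mxE mulr1n. Qed.

Definition mk_stateE := (density_mk, momentum_mk, magnetic_mk, energy_mk).

Lemma momentumE U : 0 < density U -> momentum U = density U *: velocity U.
Proof. by move=> r0; rewrite scalerA divff ?gt_eqF // scale1r. Qed.

Lemma energyE U : 0 < density U ->
  energy U = internal_energy U
    + (density U * dot (velocity U) (velocity U)
       + dot (magnetic U) (magnetic U)) / 2.
Proof.
move=> r0; rewrite /internal_energy !enorm_sqr {2}momentumE // !dotE.
by field; rewrite gt_eqF.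
Qed.

Section RelativeState.
Variables (p : R -> R -> R) (i : 'I_3) (vs Bs : 'rV[R]_3).

Definition relative_fluid_energy U : R :=
  density U * dot (velocity U - vs) (velocity U - vs) / 2 + internal_energy U.

Definition relative_magnetic_energy U : R :=
  dot (magnetic U - Bs) (magnetic U - Bs) / 2.

(** What remains of the flux of the relative energy once convection is removed:
    the work of the pressure and of the magnetic stress on the relative
    motion. *)
Definition fluctuation_flux U : R :=
  let w := velocity U - vs in let b := magnetic U - Bs in
  pressure p U * w 0 i + w 0 i * dot b (magnetic U)
  - magnetic U 0 i * dot w b.

(** Expanding the squares of the relative energies: the terms linear in [U] make
    up [nstar], and the only other one is [|Bs|^2 / 2], because the magnetic
    energy, unlike the kinetic one, is not weighted by the density. *)
Lemma dot_nstar U : 0 < density U ->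
  dot U (nstar vs Bs) + enorm Bs ^+ 2 / 2
  = relative_fluid_energy U + relative_magnetic_energy U.
Proof.
move=> r0; rewrite dot_mk_state energyE // momentumE // !enorm_sqr.
rewrite /relative_fluid_energy /relative_magnetic_energy !dotE.
rewrite (dotC vs) (dotC Bs); lra.
Qed.

(** The magnetic energy is convected with [vs] and not with the velocity of the
    state: the difference is absorbed in [fluctuation_flux], whose magnetic
    part is then written with the actual field [magnetic U]. *)
Lemma dot_flux_nstar U : 0 < density U ->
  dot (flux p i U) (nstar vs Bs) - magnetic U 0 i * dot vs Bs
    + vs 0 i * enorm Bs ^+ 2 / 2
  = velocity U 0 i * relative_fluid_energy U
    + vs 0 i * relative_magnetic_energy U
    + fluctuation_flux U.
Proof.
move=> r0; rewrite dot_mk_state !mk_stateE.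
rewrite /relative_fluid_energy /relative_magnetic_energy /fluctuation_flux.
rewrite /total_pressure.
rewrite energyE // !enorm_sqr.
move: (velocity U) (magnetic U) => v B; rewrite !dotE dot_deltal !mxE.
by rewrite (dotC vs v) (dotC vs B) (dotC Bs B); field.
Qed.

(** * Bound on the fluctuation flux *)

Lemma Ci_ge0 U : 0 <= Ci p i U.
Proof. by rewrite mulr_ge0 ?invr_ge0 ?sqrtr_ge0. Qed.

(** [Ci ^+ 2] is the larger root of the biquadratic characteristic equation of
    the magnetosonic waves with sound speed [Cs].  The discriminant is
    nonnegative because the square of one component is at most the squared norm
    of the field. *)
Lemma Ci_spec U : admissible U ->
  let C := Ci p i U in
  let a := Cs p U ^+ 2 + enorm (magnetic U) ^+ 2 / density U in
  C ^+ 4 - a * C ^+ 2 + Cs p U ^+ 2 * (magnetic U 0 i ^+ 2 / density U) = 0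
  /\ a <= 2 * C ^+ 2.
Proof.
move=> [r0 _] C a; set g := magnetic U 0 i ^+ 2 / density U.
pose d := a ^+ 2 - 4 * (Cs p U ^+ 2 * g).
have gB : g <= enorm (magnetic U) ^+ 2 / density U.
  by rewrite ler_pM2r ?invr_gt0 // enorm_sqr sqr_coord_le_dotvv.
have g0 : 0 <= g by rewrite divr_ge0 ?sqr_ge0 ?ltW.
have c0 := sqr_ge0 (Cs p U).
have a0 : 0 <= a by rewrite addr_ge0 // (le_trans g0).
have d0 : 0 <= d.
  have h : Cs p U ^+ 2 + g <= a by rewrite lerD2l.
  have : (Cs p U ^+ 2 + g) ^+ 2 <= a ^+ 2.
    by apply: lerXn2r; rewrite ?nnegrE /=; [exact: addr_ge0|exact: a0|exact: h].
  have := sqr_ge0 (Cs p U ^+ 2 - g).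
  by rewrite /d; lra.
have C2 : C ^+ 2 = (a + Num.sqrt d) / 2.
  rewrite /C /Ci -/a -mulrA -/g -/d exprMn exprVn.
  rewrite !sqr_sqrtr //; first by rewrite mulrC.
  by apply: addr_ge0 => //; exact: sqrtr_ge0.
have sd := sqr_sqrtr d0; have sd0 := sqrtr_ge0 d.
clearbody C.
split; last by rewrite C2; lra.
rewrite (exprM C 2 2) C2.
have -> : Cs p U ^+ 2 * g = (a ^+ 2 - Num.sqrt d ^+ 2) / 4.
  by rewrite sd /d; field.
by field.
Qed.

(** [fast_speed_form_bound] in symmetrised variables: [sqrt density * w], [b]
    and [sqrt (2 * internal_energy)], with the Alfven velocity
    [B / sqrt density] as [beta]. The speed [Cs] is the one for which
    [c z x_i] is the work of the pressure. *)
Lemma fluctuation_flux_bound U : admissible U ->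
  `|fluctuation_flux U|
  <= Ci p i U * (relative_fluid_energy U + relative_magnetic_energy U).
Proof.
move=> aU; have [r0 e0] := aU.
have [eqC leC] := Ci_spec aU.
(* r * t is the square root of twice the internal energy *)
set r := Num.sqrt (density U).
have r_gt0 : 0 < r by rewrite sqrtr_gt0.
have r2 : r ^+ 2 = density U by rewrite sqr_sqrtr // ltW.
have se_gt0 : 0 < 2 * specific_energy U by rewrite mulr_gt0 ?divr_gt0.
set t := Num.sqrt (2 * specific_energy U).
have t_gt0 : 0 < t by rewrite sqrtr_gt0.
have t2 : t ^+ 2 = 2 * specific_energy U by rewrite sqr_sqrtr // ltW.
have bb : dot (r^-1 *: magnetic U) (r^-1 *: magnetic U)
    = enorm (magnetic U) ^+ 2 / density U.
  by rewrite !dotE enorm_sqr -r2; field; rewrite gt_eqF.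
have := @fast_speed_form_bound R 3 i (r *: (velocity U - vs))
  (magnetic U - Bs) (r^-1 *: magnetic U) (Cs p U) (r * t) (Ci p i U)
  (Ci_ge0 U).
rewrite bb => /(_ _ leC)/wrap[].
  by rewrite -eqC !mxE -r2; congr (_ + _); field; rewrite gt_eqF.
congr (_ <= _).
  congr `|_|; rewrite /fluctuation_flux /Cs -/t !dotZl !dotZr -r2 !mxE.
  by field; rewrite ?gt_eqF.
congr (_ * _); rewrite /relative_fluid_energy /relative_magnetic_energy.
rewrite !dotZl !dotZr exprMn t2 /specific_energy mulrA -expr2 r2.
by field; rewrite gt_eqF.
Qed.

(** * Combining the two states *)

(** Cauchy-Schwarz twice, with weights: the average of the relative velocities
    is estimated in the norm given by the densities, and [b + bt] by
    [2 (|b|^2 + |bt|^2)].  Both factors are part of the relative energy, and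
    the product is at most half of the sum of the squares. *)
Lemma magnetic_jump_bound U Ut (sigma : R) : admissible U -> admissible Ut ->
  `|(sigma * (velocity U - vs) 0 i + (1 - sigma) * (velocity Ut - vs) 0 i)
      * dot (magnetic Ut - magnetic U)
            ((magnetic U - Bs) + (magnetic Ut - Bs)) / 2|
  <= enorm (magnetic Ut - magnetic U) / Num.sqrt 2
     * Num.sqrt (sigma ^+ 2 / density U + (1 - sigma) ^+ 2 / density Ut)
     * (relative_fluid_energy U + relative_magnetic_energy U
        + (relative_fluid_energy Ut + relative_magnetic_energy Ut)).
Proof.
move=> [r0 e0] [rt0 et0].
rewrite /relative_fluid_energy /relative_magnetic_energy.
set w := velocity U - vs; set wt := velocity Ut - vs.
set b := magnetic U - Bs; set bt := magnetic Ut - Bs.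
set D := magnetic Ut - magnetic U.
clearbody w wt b bt D.
set r := density U in r0 *; set rt := density Ut in rt0 *.
set x := w 0 i; set xt := wt 0 i.
set k2 := _ / r + _.
have k20 : 0 <= k2 by rewrite addr_ge0 // divr_ge0 ?sqr_ge0 ?ltW.
set h := dot b b / 2; set ht := dot bt bt / 2.
have h0 : 0 <= h by rewrite divr_ge0 ?dotvv_ge0.
have ht0 : 0 <= ht by rewrite divr_ge0 ?dotvv_ge0.
have kx : r * x ^+ 2 <= r * dot w w by rewrite ler_pM2l ?sqr_coord_le_dotvv.
have kxt : rt * xt ^+ 2 <= rt * dot wt wt.
  by rewrite ler_pM2l ?sqr_coord_le_dotvv.
have x0 : 0 <= r * x ^+ 2 by rewrite mulr_ge0 ?sqr_ge0 ?ltW.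
have xt0 : 0 <= rt * xt ^+ 2 by rewrite mulr_ge0 ?sqr_ge0 ?ltW.
set K := enorm D / Num.sqrt 2 * Num.sqrt k2.
have K0 : 0 <= K by rewrite mulr_ge0 ?divr_ge0 ?sqrtr_ge0.
have K2 : K ^+ 2 = dot D D / 2 * k2.
  by rewrite !exprMn exprVn enorm_sqr !sqr_sqrtr.
clearbody K.
set X := r * x ^+ 2 + rt * xt ^+ 2.
(* half of X + 2 * (h + ht) is the share of the energy that is used *)
apply: (@le_trans _ _ (K * ((X + 2 * (h + ht)) / 2))); last first.
  by rewrite ler_wpM2l //; move: e0 et0; rewrite /X /h /ht; lra.
apply: ler_norm_sqr.
  by rewrite mulr_ge0 // /X; lra.
have cs1 : (sigma * x + (1 - sigma) * xt) ^+ 2 <= k2 * X.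
  rewrite -subr_ge0.
  have -> : k2 * X - (sigma * x + (1 - sigma) * xt) ^+ 2
      = (sigma * rt * xt - (1 - sigma) * r * x) ^+ 2 / (r * rt).
    by rewrite /k2 /X; field; rewrite !gt_eqF.
  by rewrite divr_ge0 ?sqr_ge0 // mulr_ge0 ?ltW.
have cs2 : dot D (b + bt) ^+ 2 <= dot D D * (4 * (h + ht)).
  apply: (le_trans (dot_sqr_le _ _)).
  rewrite ler_wpM2l ?dotvv_ge0 //.
  have := dotvv_ge0 (b - bt); rewrite !dotE (dotC bt b) /h /ht; lra.
rewrite !exprMn K2 exprVn.
have cs := ler_pM (sqr_ge0 _) (sqr_ge0 _) cs1 cs2.
have D0 : 0 <= dot D D * k2 by rewrite mulr_ge0 ?dotvv_ge0.
have := mulr_ge0 D0 (sqr_ge0 (X - 2 * (h + ht))); lra.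
Qed.

Lemma relative_fluid_energy_gt0 U : admissible U -> 0 < relative_fluid_energy U.
Proof.
move=> [r0 e0]; rewrite ltr_wpDl // divr_ge0 // mulr_ge0 ?dotvv_ge0 //.
exact: ltW.
Qed.

Lemma relative_magnetic_energy_ge0 U : 0 <= relative_magnetic_energy U.
Proof. by rewrite divr_ge0 ?dotvv_ge0. Qed.

(** The arbitrary velocity [vs] is traded here for the average [V], at the price
    of the last term, which vanishes when the magnetic field does not jump. *)
Lemma flux_difference_decomposition U Ut (sigma s : R) :
  0 < density U -> 0 < density Ut ->
  let V := sigma * velocity U 0 i + (1 - sigma) * velocity Ut 0 i in
  dot (U - s *: flux p i U + Ut + s *: flux p i Ut) (nstar vs Bs)
    + enorm Bs ^+ 2 + (magnetic U 0 i - magnetic Ut 0 i) * s * dot vs Bs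
  = relative_fluid_energy U + relative_magnetic_energy U
    + (relative_fluid_energy Ut + relative_magnetic_energy Ut)
    + s * ((velocity Ut 0 i * relative_fluid_energy Ut
            + V * relative_magnetic_energy Ut
            + fluctuation_flux Ut)
           - (velocity U 0 i * relative_fluid_energy U
              + V * relative_magnetic_energy U
              + fluctuation_flux U)
           - (sigma * (velocity U - vs) 0 i
                + (1 - sigma) * (velocity Ut - vs) 0 i)
             * dot (magnetic Ut - magnetic U)
                   ((magnetic U - Bs) + (magnetic Ut - Bs)) / 2).
Proof.
move=> r0 rt0 V.
have jump : dot (magnetic Ut - magnetic U)
    ((magnetic U - Bs) + (magnetic Ut - Bs)) / 2
    = relative_magnetic_energy Ut - relative_magnetic_energy U.
  rewrite /relative_magnetic_energy; move: (magnetic U) (magnetic Ut) => B Bt.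
  by rewrite !dotE (dotC Bt B) (dotC Bs B) (dotC Bs Bt); field.
have /(canRL (addrK _)) SU := dot_nstar r0.
have /(canRL (addrK _)) SUt := dot_nstar rt0.
have /(canRL (addrK _))/(canRL (subrK _)) FU := dot_flux_nstar r0.
have /(canRL (addrK _))/(canRL (subrK _)) FUt := dot_flux_nstar rt0.
rewrite -[_ * dot _ (_ + _) / 2]mulrA jump !(dotDl, dotNl, dotZl).
rewrite SU SUt FU FUt /V; move: (velocity U) (velocity Ut) => v vt.
by rewrite !mxE; field.
Qed.

End RelativeState.

(** Each part of the relative energy is transported at a speed at most the
    maximum in [alpha_sigma]: the fluid part of each state at its own velocity,
    the magnetic parts at the averaged velocity, in both cases up to [Ci].  The
    magnetic jump accounts for the second summand of [alpha_sigma]. *)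
Lemma flux_difference_pos (p : R -> R -> R) (i : 'I_3) U Ut
    (sigma s : R) (vs Bs : 'rV[R]_3) :
  admissible U -> admissible Ut -> `|s| * alpha_sigma p i U Ut sigma < 1 ->
  0 < dot (U - s *: flux p i U + Ut + s *: flux p i Ut) (nstar vs Bs)
    + enorm Bs ^+ 2 + (magnetic U 0 i - magnetic Ut 0 i) * s * dot vs Bs.
Proof.
move=> aU aUt; have [r0 _] := aU; have [rt0 _] := aUt.
rewrite (flux_difference_decomposition p i vs Bs sigma s r0 rt0).
have k0 := relative_fluid_energy_gt0 vs aU.
have kt0 := relative_fluid_energy_gt0 vs aUt.
have h0 := relative_magnetic_energy_ge0 Bs U.
have ht0 := relative_magnetic_energy_ge0 Bs Ut.
have Qb := fluctuation_flux_bound p i vs Bs aU.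
have Qtb := fluctuation_flux_bound p i vs Bs aUt.
have Jb := magnetic_jump_bound i vs Bs sigma aU aUt.
move: k0 kt0 h0 ht0 Qb Qtb Jb; rewrite /alpha_sigma.
set k := relative_fluid_energy _ _; set kt := relative_fluid_energy _ Ut.
set h := relative_magnetic_energy _ _; set ht := relative_magnetic_energy _ Ut.
set Q := fluctuation_flux _ _ _ _ _; set Qt := fluctuation_flux _ _ _ _ Ut.
set J := _ * _ / 2; set L := _ / _ * _.
set v := velocity U 0 i; set vt := velocity Ut 0 i.
set V := sigma * v + _; set C := Ci p i U; set Ct := Ci p i Ut.
set M := Num.max _ _ => k0 kt0 h0 ht0 Qb Qtb Jb sa.
have Mv : `|v| + C <= M by rewrite le_max lexx.
have Mvt : `|vt| + Ct <= M by rewrite !le_max lexx orbT.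
have MV : `|V| + C <= M.
  by rewrite !le_max lerD2l le_max lexx !orbT.
have MVt : `|V| + Ct <= M.
  by rewrite !le_max lerD2l le_max lexx !orbT.
set W := k + h + (kt + ht); set F := _ - J.
have W0 : 0 < W by rewrite /W; lra.
have FW : `|F| <= (M + L) * W.
  have state_bound (v' V' C' Q' k' h' : R) : 0 <= k' -> 0 <= h' ->
      `|v'| + C' <= M -> `|V'| + C' <= M -> `|Q'| <= C' * (k' + h') ->
      `|v' * k' + V' * h' + Q'| <= M * (k' + h').
    move=> k'0 h'0 b1 b2 b3.
    apply: (le_trans (ler_normD _ _)).
    apply: (le_trans (lerD (ler_normD _ _) b3)).
    rewrite !normrM (ger0_norm k'0) (ger0_norm h'0).
    have := ler_wpM2r k'0 b1; have := ler_wpM2r h'0 b2; lra.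
  have b1 := state_bound _ _ _ _ _ _ (ltW k0) h0 Mv MV Qb.
  have b2 := state_bound _ _ _ _ _ _ (ltW kt0) ht0 Mvt MVt Qtb.
  apply: (le_trans (ler_normB _ _)).
  apply: (le_trans (lerD (ler_normB _ _) Jb)).
  by apply: le_trans (lerD (lerD b2 b1) (lexx _)) _; rewrite /W; lra.
have sF : `|s * F| < W.
  rewrite normrM; apply: (le_lt_trans (ler_wpM2l (normr_ge0 s) FW)).
  by rewrite mulrA gtr_pMl.
by move: sF; rewrite ltr_norml => /andP[]; lra.
Qed.

(** * The minimum over the averaging parameter *)

Lemma alpha_sigma_continuous (p : R -> R -> R) (i : 'I_3) U Ut :
  continuous (alpha_sigma p i U Ut).
Proof.
have cst (a : R) : continuous (fun _ : R => a) by move=> x; exact: cvg_cst.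
have idc : continuous (fun s : R => s) by move=> x; exact: cvg_id.
have add (f g : R -> R) : continuous f -> continuous g ->
    continuous (fun s => f s + g s).
  by move=> cf cg x; apply: cvgD; [exact: cf|exact: cg].
have mul (f g : R -> R) : continuous f -> continuous g ->
    continuous (fun s => f s * g s).
  by move=> cf cg x; apply: cvgM; [exact: cf|exact: cg].
have max (f g : R -> R) : continuous f -> continuous g ->
    continuous (fun s => Num.max (f s) (g s)).
  by move=> cf cg x; apply: continuous_max; [exact: cf|exact: cg].
have norm (f : R -> R) : continuous f -> continuous (fun s => `|f s|).
  by move=> cf x; apply: cvg_norm; exact: cf.
have sqrt (f : R -> R) : continuous f -> continuous (fun s => Num.sqrt (f s)).
  by move=> cf x; apply: continuous_comp; [exact: cf|exact: sqrt_continuous].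
have sub1 : continuous (fun s : R => 1 - s).
  by move=> x; apply: cvgB; [exact: cst|exact: idc].
apply: (add).
  apply: (max _ _ (cst _)); apply: (max _ _ (cst _)).
  apply: (add); last exact: cst.
  by apply: (norm); apply: (add); apply: (mul).
apply: (mul) => //; apply: (sqrt); apply: (add); apply: (mul) => //.
  exact: (mul _ _ idc idc).
exact: (mul _ _ sub1 sub1).
Qed.

Lemma alpha_sigma_has_min (p : R -> R -> R) (i : 'I_3) U Ut :
  admissible U -> admissible Ut ->
  exists s0, forall s, alpha_sigma p i U Ut s0 <= alpha_sigma p i U Ut s.
Proof.
move=> [r0 _] [rt0 _].
set v := velocity U 0 i; set vt := velocity Ut 0 i.
set D := enorm (magnetic Ut - magnetic U) / Num.sqrt 2.
have D0 : 0 <= D by rewrite divr_ge0 ?sqrtr_ge0.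
set q := Num.sqrt (density U)^-1.
have q0 : 0 < q by rewrite sqrtr_gt0 invr_gt0.
(* Lower bound for the growth rate of alpha_sigma: the averaged velocity
   contributes `|v - vt|, the square root at least D * q. *)
have [k0|] := ltP 0 (`|v - vt| + D * q).
  apply: (coercive_has_min (l := `|vt|) (@alpha_sigma_continuous p i U Ut) k0).
  move=> s.
  have le1 : `|s * v + (1 - s) * vt| <= Num.max (`|v| + Ci p i U)
    (Num.max (`|vt| + Ci p i Ut)
       (`|s * v + (1 - s) * vt| + Num.max (Ci p i U) (Ci p i Ut))).
    by rewrite !le_max lerDl le_max Ci_ge0 !orbT.
  have le2 : `|v - vt| * `|s| - `|vt| <= `|s * v + (1 - s) * vt|.
    have -> : s * v + (1 - s) * vt = (v - vt) * s - - vt by ring.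
    by rewrite -normrM -[X in _ - X <= _]normrN lerB_dist.
  have le3 : q * `|s| <= Num.sqrt (s ^+ 2 / density U
                                   + (1 - s) ^+ 2 / density Ut).
    rewrite -sqrtr_sqr -sqrtrM; last by rewrite invr_ge0 ltW.
    by apply: ler_wsqrtr; rewrite mulrC lerDl divr_ge0 ?sqr_ge0 ?ltW.
  have := ler_wpM2l D0 le3.
  by rewrite /alpha_sigma -/v -/vt -/D; lra.
move=> k0.
have Dq0 : 0 <= D * q by rewrite mulr_ge0 // ltW.
have vvt0 := normr_ge0 (v - vt).
have /eqP : `|v - vt| = 0 by lra.
rewrite normr_eq0 subr_eq0 => /eqP vvt.
have /eqP : D * q = 0 by lra.
rewrite mulf_eq0 (gt_eqF q0) orbF => /eqP Dz.
exists 0 => s; rewrite /alpha_sigma -/v -/vt -/D Dz !mul0r vvt.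
have -> : s * vt + (1 - s) * vt = vt by ring.
have -> : 0 + (1 - 0) * vt = vt by ring.
by [].
Qed.

End MHD.

Theorem lemma2p6 (R : realType) (p : R -> R -> R)
    (hp : equation_of_state p) (i : 'I_3) (U Ut : state R)
    (hU : admissible U) (hUt : admissible Ut) :
  is_min (range (alpha_sigma p i U Ut)) (alpha_min p i U Ut) /\
  forall (vs Bs : 'rV[R]_3) (alpha : R),
    alpha_min p i U Ut < `|alpha| ->
    dot (U - alpha^-1 *: flux p i U + Ut + alpha^-1 *: flux p i Ut)
        (nstar vs Bs)
    + enorm Bs ^+ 2
    + (magnetic U 0 i - magnetic Ut 0 i) / alpha * dot vs Bs > 0.
Proof.
have minP : is_min (range (alpha_sigma p i U Ut)) (alpha_min p i U Ut).
  have [s0 s0P] := alpha_sigma_has_min p i hU hUt.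
  apply: (@xgetPex _ 0 [set a | is_min (range (alpha_sigma p i U Ut)) a]).
  exists (alpha_sigma p i U Ut s0); split; first by exists s0.
  by move=> _ [s _ <-]; exact: s0P.
split=> // vs Bs alpha.
have [[sigma _ <-] _] := minP => lt_alpha.
apply: (flux_difference_pos (sigma := sigma)) => //.
have alpha_gt0 : 0 < `|alpha|.
  apply: le_lt_trans lt_alpha; rewrite addr_ge0 //.
    by rewrite le_max addr_ge0 ?Ci_ge0.
  by rewrite mulr_ge0 ?divr_ge0 ?sqrtr_ge0.
by rewrite normfV mulrC ltr_pdivrMr // mul1r.
Qed.
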